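(* Let $\mathcal{U}\subset\mathbb{R}^3$ be a set of points that contains two orthogonal vectors $u$ and $v$. Then $\mathcal{U}$ can be rotated into the nonnegative octant $\mathbb{R}^3_{\geq 0}$ if and only if it can be rotated into $\mathbb{R}^3_{\geq 0}$ with at least one of the vectors $u$ and $v$ along a coordinate axis; that is, there is an orthogonal matrix $Q$ with $Q\,\mathcal{U}\subset\mathbb{R}^3_{\geq 0}$ if and only if there is an orthogonal matrix $Q$ with $Q\,\mathcal{U}\subset\mathbb{R}^3_{\geq 0}$ such that at least one of $Qu$, $Qv$ is a nonnegative multiple of a standard basis vector of $\mathbb{R}^3$.
   Context: $\mathbb{R}^3_{\geq 0}$ is the set of vectors in $\mathbb{R}^3$ with all coordinates nonnegative. ''Rotated into'' and ''isometrically embedded into'' $\mathbb{R}^3_{\geq 0}$ are used interchangeably: they mean mapped into $\mathbb{R}^3_{\geq 0}$ by a linear isometry (orthogonal $3\times 3$ matrix) of $\mathbb{R}^3$. *)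

(* Defs.v *)
From mathcomp Require Import all_boot all_order all_algebra.
From mathcomp Require Import boolp classical_sets reals.

Set Implicit Arguments.
Unset Strict Implicit.
Unset Printing Implicit Defensive.

Import Order.TTheory GRing.Theory Num.Theory.

Local Open Scope classical_set_scope.
Local Open Scope ring_scope.

(* Vectors of R^n are columns, so that a matrix Q acts by Q *m x. *)

Definition dotv (R : realType) (n : nat) (x y : 'cV[R]_n) : R :=
  \sum_i x i 0 * y i 0.

(* The library's [unitarymx] is only available over a field of complex
   numbers. *)
Definition orthogonal_mx (R : realType) (n : nat) (Q : 'M[R]_n) : Prop :=
  Q^T *m Q = 1%:M.

Definition nonneg_orthant (R : realType) (n : nat) : set 'cV[R]_n :=
  [set x | forall i, 0 <= x i 0].

(* [delta_mx i 0 : 'cV_n] is the i-th standard basis vector; c = 0 is allowed. *)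
Definition along_axis (R : realType) (n : nat) (x : 'cV[R]_n) : Prop :=
  exists (i : 'I_n) (c : R), 0 <= c /\ x = c *: delta_mx i 0.

(* Main.v *)
Require Import Defs.
From mathcomp Require Import all_boot all_order all_algebra.
From mathcomp Require Import boolp classical_sets reals.

(** Only the left-to-right implication has content, and the rotation that is
    given already works.  An orthogonal matrix [Q] preserves the inner product,
    so [Q *m u] and [Q *m v] are orthogonal; as both have nonnegative entries,
    no term of their inner product can cancel another, so their supports are
    disjoint ([nonneg_dotv0_disjoint]).  Two disjoint subsets of the three
    coordinates cannot both have two elements, so one of the two vectors has at
    most one nonzero entry, and a nonnegative vector of that kind lies along an
    axis ([along_axis_supp_le1]). *)

Import Order.TTheory GRing.Theory Num.Theory.

Local Open Scope ring_scope.

Definition supp {R : realType} {n : nat} (x : 'cV[R]_n) : {set 'I_n} :=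
  [set i | x i 0 != 0].

Lemma dotvE (R : realType) (n : nat) (x y : 'cV[R]_n) :
  dotv x y = (x^T *m y) 0 0.
Proof. by rewrite mxE; apply: eq_bigr => i _; rewrite mxE. Qed.

Lemma dotv_orthogonal_mx (R : realType) (n : nat) (Q : 'M[R]_n)
    (x y : 'cV[R]_n) :
  orthogonal_mx Q -> dotv (Q *m x) (Q *m y) = dotv x y.
Proof.
by move=> oQ; rewrite !dotvE trmx_mul -mulmxA (mulmxA Q^T) oQ mul1mx.
Qed.

(** A sum of nonnegative terms vanishes only if every term does. *)
Lemma nonneg_dotv0_disjoint (R : realType) (n : nat) (x y : 'cV[R]_n) :
  nonneg_orthant x -> nonneg_orthant y -> dotv x y = 0 ->
  [disjoint supp x & supp y].
Proof.
move=> x0 y0 /psumr_eq0P xy0; apply/pred0P => i /=; rewrite !inE.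
by rewrite -negb_or -mulf_eq0 xy0 ?eqxx // => j _; exact: mulr_ge0.
Qed.

(** The dimension is a successor because the zero vector, whose support names
    no axis, still needs one. *)
Lemma along_axis_supp_le1 (R : realType) (n : nat) (x : 'cV[R]_n.+1) :
  nonneg_orthant x -> (#|supp x| <= 1)%N -> along_axis x.
Proof.
move=> x0 /card_le1_eqP x1.
have [k xk] : exists k, forall i, i != k -> x i 0 = 0.
  have [s0 | [k kx]] := set_0Vmem (supp x).
    exists ord0 => i _; apply/eqP; apply: contraT => xi.
    have : i \in supp x by rewrite inE.
    by rewrite s0 inE.
  exists k => i; apply: contraNeq => xi.
  by apply/eqP/x1; rewrite // inE.
exists k, (x k 0); split; first exact: x0.
apply/colP => i; rewrite !mxE eqxx andbT.
by case: (eqVneq i k) => [-> | /xk ->]; rewrite ?mulr1 ?mulr0.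
Qed.

Lemma nonneg_dotv0_along_axis (R : realType) (x y : 'cV[R]_3) :
  nonneg_orthant x -> nonneg_orthant y -> dotv x y = 0 ->
  along_axis x \/ along_axis y.
Proof.
move=> x0 y0 /(nonneg_dotv0_disjoint _ _ _ _ x0 y0) xy.
have le3 : (#|supp x| + #|supp y| <= 3)%N.
  move: xy; rewrite -leq_card_setU => /eqP <-.
  by rewrite -[leqRHS]card_ord max_card.
have [x1 | x2] := leqP #|supp x| 1; [left | right];
  apply: along_axis_supp_le1 => //.
by rewrite -(leq_add2l 2); apply: leq_trans le3; rewrite leq_add2r.
Qed.

Local Open Scope classical_set_scope.
Local Open Scope ring_scope.

Theorem proposition1p2 (R : realType) (U : set 'cV[R]_3) (u v : 'cV[R]_3)
    (Uu : U u) (Uv : U v) (uv : dotv u v = 0) :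
  (exists Q : 'M[R]_3,
      orthogonal_mx Q /\ [set Q *m x | x in U] `<=` @nonneg_orthant R 3)
  <->
  (exists Q : 'M[R]_3,
      [/\ orthogonal_mx Q,
          [set Q *m x | x in U] `<=` @nonneg_orthant R 3
        & along_axis (Q *m u) \/ along_axis (Q *m v)]).
Proof.
split=> [[Q [oQ QU]] | [Q [oQ QU _]]]; exists Q; split=> //.
apply: nonneg_dotv0_along_axis.
- by apply: QU; exists u.
- by apply: QU; exists v.
- by rewrite dotv_orthogonal_mx.
Qed.
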